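(* Let $\delta > 0$ and let $x,y \in \mathbb{C}^L$ be $B$-bandlimited, for some $B \in \mathbb{N}_0$. For the essential support graph $G_\delta = (V_\delta,E)$ of $x$, assume that the subgraph of $G_\delta$ induced by the vertex set $S_\delta = V_\delta \cap \operatorname{supp} y$ has $K$ connected components whose vertex sets are denoted by $\{S_k\}_{k=1}^K$. If $\phi \in \mathbb{C}^L$ is such that $$\min_{\substack{m \in \{0,1\}\\ n \in \{-2B,\dots,2B\}}} \lvert \mathcal{A}[\phi](m,n)\rvert \geq \frac{1}{c}$$ for some $c > 0$, then $$\inf_{\alpha_1,\dots,\alpha_K \in \mathbb{R}} \sum_{k=1}^K \left\lVert x - \mathrm{e}^{\mathrm{i}\alpha_k} y\right\rVert_{\ell^2(S_k)} \leq \frac{c\sqrt{K}}{\delta}\left(1 + \frac{\sqrt{2\lvert S_\delta\rvert}\, \lVert x\rVert_{\ell^2(S_\delta)}}{\delta}\right)\left\lVert M_\phi[x]-M_\phi[y]\right\rVert_{\mathrm{F}}.$$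
   Context: Fix $L \in \mathbb{N}$. Vectors in $\mathbb{C}^L$ are indexed by $\{0,\dots,L-1\}$, and all indexing (of vectors and of $L\times L$ arrays) is periodic modulo $L$, e.g. $\phi(\ell) = \phi(\ell \bmod L)$ for $\ell \in \mathbb{Z}$. The support is $\operatorname{supp} x = \{\ell \in \{0,\dots,L-1\} : x(\ell) \neq 0\}$. The discrete Fourier transform (DFT) is $\mathcal{F}[x](k) = \frac{1}{\sqrt{L}}\sum_{\ell=0}^{L-1} x(\ell)\mathrm{e}^{-2\pi\mathrm{i}\ell k/L}$. The discrete Gabor transform of $x \in \mathbb{C}^L$ with window $\phi \in \mathbb{C}^L$ is $\mathcal{V}_\phi[x](m,n) = \frac{1}{\sqrt{L}} \sum_{\ell=0}^{L-1} x(\ell)\overline{\phi(\ell-m)}\mathrm{e}^{-2\pi\mathrm{i}\ell n/L}$, $m,n = 0,\dots,L-1$. The ambiguity function is $\mathcal{A}[x] := \mathcal{V}_x[x]$, and the measurements are $M_\phi[x](m,n) := \lvert \mathcal{V}_\phi[x](m,n)\rvert^2$, $m,n=0,\dots,L-1$. $\lVert\cdot\rVert_{\mathrm{F}}$ is the Frobenius norm of $L\times L$ matrices. For $B \in \mathbb{N}_0$, $x \in \mathbb{C}^L$ is $B$-bandlimited if $\operatorname{supp} \mathcal{F}[x] \subset \{-B,\dots,B\} \bmod L$. For $S \subset \{0,\dots,L-1\}$, $\lVert x \rVert_{\ell^2(S)} = \left(\sum_{\ell \in S} \lvert x(\ell)\rvert^2\right)^{1/2}$, and $\lvert S\rvert$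 is the cardinality of $S$. For $\delta > 0$, the essential support graph of $x$ (with time separation parameter zero) is the graph $G_\delta = (V_\delta,E)$ with vertex set $V_\delta = \{\ell \in \{0,\dots,L-1\} : \lvert x(\ell)\rvert \geq \delta\}$ and an edge between $\ell,k \in V_\delta$ if $\lvert \ell-k\rvert \in (0,1] \cup [L-1,L)$. *)

(* Defs.v *)
From HB Require Import structures.
From mathcomp Require Import all_boot all_order all_algebra.
From mathcomp Require Import complex.
From mathcomp Require Import classical_sets reals trigo.

Set Implicit Arguments.
Unset Strict Implicit.
Unset Printing Implicit Defensive.

Import Order.TTheory GRing.Theory Num.Theory.

Local Open Scope ring_scope.
Local Open Scope complex_scope.

(* The library norm `|z| on R[i] takes its values in R[i]; [normc z] is the
   same modulus as an element of R. *)
Notation normc := ComplexField.Normc.normc.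

Definition expi (R : realType) (t : R) : R[i] := cos t +i* sin t.

Section Signals.
Variables (R : realType) (L : nat).
Implicit Types (x phi : 'cV[R[i]]_L) (l m n : int) (delta : R).

(* The value x(l mod L) at an arbitrary integer l; the default 0 is only
   reached when L = 0. *)
Definition per x l : R[i] :=
  oapp (fun i : 'I_L => x i 0) 0 (insub `|(l %% L%:Z)%Z|%N).

Definition supp x : {set 'I_L} := [set i | x i 0 != 0].

Definition dft x : 'cV[R[i]]_L :=
  \col_(k < L) ((Num.sqrt L%:R)^-1%:C *
    \sum_(l < L) x l 0 * expi (- (2 * pi * l%:R * k%:R / L%:R))).

(* The time and frequency shifts are arbitrary integers; the value is
   L-periodic in both, which is the periodic indexing convention. *)
Definition gabor phi x m n : R[i] :=
  (Num.sqrt L%:R)^-1%:C *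
    \sum_(l < L) x l 0 * (per phi (l%:Z - m))^* *
      expi (- (2 * pi * l%:R * n%:~R / L%:R)).

Definition ambiguity x m n := gabor x x m n.

Definition measurements phi x : 'M[R]_L :=
  \matrix_(m < L, n < L) normc (gabor phi x m%:Z n%:Z) ^+ 2.

Definition frobenius (M : 'M[R]_L) : R :=
  Num.sqrt (\sum_(i < L) \sum_(j < L) `|M i j| ^+ 2).

(* {-B, ..., B} mod L *)
Definition band (B : nat) : {set 'I_L} :=
  [set k : 'I_L |
    [exists b : 'I_(2 * B).+1, (k%:Z == b%:Z - B%:Z %[mod L%:Z])%Z]].

Definition bandlimited (B : nat) x : bool := supp (dft x) \subset band B.

Definition l2norm (S : {set 'I_L}) x : R :=
  Num.sqrt (\sum_(l in S) normc (x l 0) ^+ 2).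

(* min of |A[phi](m,n)| over m in {0,1} and n in {-2B,...,2B}, where n runs
   over the integers j - 2B with 0 <= j <= 4B.  The initial value of the
   iterated minimum is the member of the family with m = n = 0. *)
Definition min_ambiguity (B : nat) phi : R :=
  let a0 := normc (ambiguity phi 0 0) in
  \big[Num.min/a0]_(m < 2) \big[Num.min/a0]_(j < (4 * B).+1)
    normc (ambiguity phi m%:Z (j%:Z - (2 * B)%:Z)).

Definition ess_vertices delta x : {set 'I_L} :=
  [set l : 'I_L | delta <= normc (x l 0)].

Definition ess_edge delta x : rel 'I_L := fun l k : 'I_L =>
  let d := `|l%:Z - k%:Z|%N in
  [&& l \in ess_vertices delta x, k \in ess_vertices delta x &
      (0 < d <= 1)%N || (L - 1 <= d < L)%N].

End Signals.

Definition induced (T : finType) (e : rel T) (S : {set T}) : rel T :=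
  fun u v => [&& u \in S, v \in S & e u v].

(* The set of vertex sets of the connected components of the (undirected)
   graph with vertex set S and edge relation induced by e. *)
Definition components (T : finType) (e : rel T) (S : {set T}) :
    {set {set T}} :=
  [set [set v in S | connect (induced e S) u v] | u in S].

(* Main.v *)
(* Taking the discrete Fourier transform of the spectrogram |V_phi x|^2 in both
   variables gives A[x] times the conjugate of A[phi].  For B-bandlimited
   signals A[x](m, .) is supported on {-2B, ..., 2B}, where |A[phi](m, .)| is at
   least 1/c for m = 0, 1; hence, by Parseval, the l^2 distances between |x|^2
   and |y|^2 and between the lag-one products x(l) x(l-1)^* and y(l) y(l-1)^*
   are both at most D = c |M[x] - M[y]|_F.  The former controls the moduli.
   Write z(l) for the relative phase of x(l) and y(l).  If D < delta^2, the
   lag-one bound controls the variation of z across each edge with constant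
   sqrt 2 / delta^2, and summing along a simple path with Cauchy-Schwarz controls
   z - z(root) on a component; if D >= delta^2, the same estimate follows from
   |z(l) - z(root)| <= 2, since a component with a non-root vertex has at least
   two elements.  Finally alpha_k is chosen as the argument of z(root). *)
Require Import Defs.
From HB Require Import structures.
From mathcomp Require Import all_boot all_order all_algebra.
From mathcomp Require Import complex.
From mathcomp Require Import classical_sets reals trigo.
From mathcomp Require Import ring lra zify.

Set Implicit Arguments.
Unset Strict Implicit.
Unset Printing Implicit Defensive.

Import Order.TTheory GRing.Theory Num.Theory.

Local Open Scope complex_scope.
Local Open Scope ring_scope.

(** * Complex modulus with values in the real field *)

Section Modulus.
Variable R : rcfType.
Implicit Types z w : R[i].

Lemma normc_ge0 z : 0 <= normc z.
Proof. by case: z => a b; rewrite /= sqrtr_ge0. Qed.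

Lemma normc_sqr z : normc z ^+ 2 = complex.Re z ^+ 2 + complex.Im z ^+ 2.
Proof. by case: z => a b /=; rewrite sqr_sqrtr // addr_ge0 // sqr_ge0. Qed.

Lemma conjE (a b : R) : (a +i* b)^* = a -i* b.
Proof. by []. Qed.

Lemma conj_real (a : R) : (a%:C : R[i])^* = a%:C.
Proof. by rewrite conjE oppr0. Qed.

Lemma mulc_conj z : z * z^* = (normc z ^+ 2)%:C.
Proof.
rewrite normc_sqr; case: z => a b; rewrite conjE.
by apply/eqP; rewrite eq_complex /=; apply/andP; split; apply/eqP; ring.
Qed.

Lemma normc_conj z : normc z^* = normc z.
Proof. by case: z => a b; rewrite conjE /= sqrrN. Qed.

Lemma normc_real (a : R) : normc a%:C = `|a|.
Proof. by rewrite /= expr0n addr0 sqrtr_sqr. Qed.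

Lemma normc_eq0 z : (normc z == 0) = (z == 0).
Proof.
apply/eqP/eqP => [|->]; first exact: ComplexField.Normc.eq0_normc.
exact: ComplexField.Normc.normc0.
Qed.

Lemma normc_subC z w : normc (z - w) = normc (w - z).
Proof. by rewrite -normcN opprB. Qed.

Lemma normc_distD u z w : normc (z - w) <= normc (z - u) + normc (u - w).
Proof. by rewrite -[z - w](subrKA u) le_normcD. Qed.

End Modulus.

(** * The unit circle and its parametrisation *)

Section Expi.
Variable R : realType.
Implicit Types t : R.

Lemma expiD s t : expi (s + t) = expi s * expi t.
Proof.
rewrite /expi cosD sinD; apply/eqP; rewrite eq_complex /=.
by apply/andP; split; apply/eqP; ring.
Qed.

Lemma expi0 : expi (0 : R) = 1.
Proof. by rewrite /expi cos0 sin0. Qed.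

Lemma expiN t : expi (- t) = (expi t)^*.
Proof. by rewrite /expi cosN sinN. Qed.

Lemma normc_expi t : normc (expi t) = 1.
Proof. by rewrite /= cos2Dsin2 sqrtr1. Qed.

(** For [z = a +i* b] on the circle, the sine of [acos a] is [|b|], so the sign of [b] selects
    [acos a] or its opposite. *)
Lemma expi_surj (z : R[i]) : normc z = 1 -> exists t, z = expi t.
Proof.
move=> z1; have := normc_sqr z; rewrite {}z1; case: z => a b /= ab1.
have a1 : -1 <= a <= 1 by apply/andP; split; nra.
have := sin_acos a1; have -> : 1 - a ^+ 2 = b ^+ 2 by lra.
rewrite sqrtr_sqr => sa; have [b0|b0] := leP 0 b.
  by exists (acos a); rewrite /expi acosK ?in_itv //= sa ger0_norm.
exists (- acos a).
by rewrite /expi cosN sinN acosK ?in_itv //= sa ltr0_norm // opprK.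
Qed.

End Expi.

(** * Characters of the cyclic group of order [L], orthogonality and Parseval *)

Section Characters.
Variables (R : realType) (n : nat).
Local Notation L := n.+1.
Local Notation C := R[i].
Implicit Types (t : int) (a b : 'I_L).

Definition unity_root t : C := expi (2 * pi * t%:~R / L%:R).

Lemma unity_rootD s t : unity_root (s + t) = unity_root s * unity_root t.
Proof. by rewrite /unity_root -expiD intrD mulrDr mulrDl. Qed.

Lemma unity_root0 : unity_root 0 = 1.
Proof. by rewrite /unity_root mulr0 mul0r expi0. Qed.

Lemma unity_rootN t : unity_root (- t) = (unity_root t)^*.
Proof. by rewrite /unity_root -expiN mulrNz mulrN mulNr. Qed.

Lemma unity_root_mulL t : unity_root (t * L%:Z) = 1.
Proof.
have pos (k : nat) : unity_root (k%:Z * L%:Z) = 1.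
  elim: k => [|k IHk]; first by rewrite mul0r unity_root0.
  rewrite -addn1 PoszD mulrDl mul1r unity_rootD IHk mul1r /unity_root.
  rewrite mulfK ?pnatr_eq0 // /expi mulrC mulr_natr.
  by rewrite cos2pi sin2pi.
by case: t => k; rewrite ?pos // NegzE mulNr unity_rootN pos conjC1.
Qed.

Lemma unity_root_mod s t : (s = t %[mod L])%Z -> unity_root s = unity_root t.
Proof.
have modE u : unity_root u = unity_root (u %% L)%Z.
  by rewrite {1}(divz_eq u L) unity_rootD unity_root_mulL mul1r.
by move=> st; rewrite modE st -modE.
Qed.

(** With [u = pi k / L] the real part is [cos (2 u) = 1 - 2 sin^2 u], and [sin u > 0] because
    [0 < u < pi]. *)
Lemma unity_root_neq1 (k : nat) : (0 < k < L)%N -> unity_root k%:Z != 1.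
Proof.
case/andP=> k0 kL; rewrite /unity_root.
set u : R := pi * k%:R / L%:R.
have -> : 2 * pi * k%:~R / L%:R = u *+ 2 by rewrite /u mulr2n; ring.
rewrite eq_complex negb_and; apply/orP; left; apply/eqP => /=.
rewrite cos_mulr2n cos2sin2 => E.
have : 0 < sin u.
  apply: sin_gt0_pi; rewrite /u divr_gt0 ?mulr_gt0 ?pi_gt0 ?ltr0n //=.
  by rewrite ltr_pdivrMr ?ltr0n // ltr_pM2l ?pi_gt0 // ltr_nat.
by move=> s0; have : 0 < sin u ^+ 2 by [exact: exprn_gt0]; lra.
Qed.

Definition chi a b : C := unity_root (a%:Z * b%:Z).

Lemma chiC a b : chi a b = chi b a.
Proof. by rewrite /chi mulrC. Qed.

Lemma Posz_ordD a b : Posz (val (a + b)) = ((a%:Z + b%:Z) %% L)%Z.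
Proof. by rewrite -PoszD modz_nat. Qed.

Lemma chiDl a b c : chi (a + b) c = chi a c * chi b c.
Proof.
rewrite /chi -unity_rootD -mulrDl; apply: unity_root_mod.
by rewrite Posz_ordD modzMml.
Qed.

Lemma chi0l b : chi 0 b = 1.
Proof. by rewrite /chi mul0r unity_root0. Qed.

Lemma chi_conj a b : chi a b * (chi a b)^* = 1.
Proof. by rewrite mulc_conj /chi normc_expi expr1n. Qed.

Lemma chiNl a b : chi (- a) b = (chi a b)^*.
Proof.
by rewrite -[LHS]mul1r -(chi_conj a b) mulrAC -chiDl subrr chi0l mul1r.
Qed.

Lemma chiDr a b c : chi c (a + b) = chi c a * chi c b.
Proof. by rewrite chiC chiDl !(chiC _ c). Qed.

Lemma chiNr a b : chi b (- a) = (chi b a)^*.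
Proof. by rewrite chiC chiNl chiC. Qed.

Lemma chi1_neq1 a : a != 0 -> chi (inord 1) a != 1.
Proof.
move=> a0; have a_gt0 : (0 < a)%N by rewrite lt0n -(inj_eq val_inj) in a0 *.
(* A nonzero [a] excludes [L = 1], where [inord 1] would be the zero element. *)
have L1 : (1 < L)%N by apply: leq_ltn_trans (ltn_ord a).
by rewrite /chi inordK // mul1r unity_root_neq1 // a_gt0 ltn_ord.
Qed.

(** Orthogonality: shifting the summation variable by 1 multiplies the sum by [chi (inord 1) a],
    which differs from 1 unless [a = 0]. *)
Lemma sum_chi a : \sum_b chi b a = L%:R * (a == 0)%:R.
Proof.
have [->|a0] := eqVneq a 0.
  under eq_bigr do rewrite chiC chi0l.
  by rewrite sumr_const card_ord mulr1.
rewrite mulr0; apply/eqP; set s := \sum_b _.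
have : chi (inord 1) a * s = s.
  rewrite /s big_distrr /= [RHS](reindex_inj (addrI (inord 1))) /=.
  by apply: eq_bigr => b _; rewrite chiDl.
move/eqP; rewrite -subr_eq0 -{2}[s]mul1r -mulrBl mulf_eq0 subr_eq0.
by rewrite (negbTE (chi1_neq1 a0)).
Qed.

Lemma parseval (f : 'I_L -> C) :
  \sum_k normc (\sum_l f l * (chi l k)^*) ^+ 2 = L%:R * \sum_l normc (f l) ^+ 2.
Proof.
(* Moved into [R[i]], each squared modulus becomes [z * z^*] and expands to a double sum, of which
   orthogonality leaves the diagonal. *)
apply: (@complexI R); rewrite rmorphM rmorph_nat !rmorph_sum /=.
under eq_bigr => k _.
  rewrite -mulc_conj rmorph_sum big_distrlr /=.
  under eq_bigr => l _. under eq_bigr => l' _.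
    rewrite rmorphM /= conjCK mulrACA -(chiNl l k) -chiDl.
    over.
  over.
  over.
rewrite exchange_big /= big_distrr /=; apply: eq_bigr => l _.
rewrite exchange_big /= (bigD1 l) //= [X in _ + X]big1 => [|l' l'l].
  under eq_bigr do rewrite addrC subrr chi0l mulr1.
  by rewrite sumr_const card_ord addr0 mulc_conj mulr_natl.
rewrite -big_distrr /=; under eq_bigr do rewrite chiC.
by rewrite sum_chi addrC subr_eq0 (negbTE l'l) !mulr0.
Qed.

Lemma parseval_conj (f : 'I_L -> C) :
  \sum_k normc (\sum_l f l * chi l k) ^+ 2 = L%:R * \sum_l normc (f l) ^+ 2.
Proof.
rewrite -parseval (reindex_inj oppr_inj) /=.
by apply: eq_bigr => k _; under eq_bigr do rewrite chiNr.
Qed.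

End Characters.
Arguments chi {R n} a b.
Arguments chiC {R n} a b.

(** * Gabor transform, ambiguity function and lag products *)

Section GaborTransform.
Variables (R : realType) (n : nat).
Local Notation L := n.+1.
Local Notation C := R[i].
Implicit Types (x y phi : 'cV[C]_L) (m k : int) (p l : 'I_L).

(** Reduction from the integers to the additive group ['I_L]; it turns periodic indexing into group
    subtraction. *)
Definition residue m : 'I_L := inord `|(m %% L)%Z|.

Lemma Posz_inj : injective Posz.
Proof. by move=> ? ? []. Qed.

Lemma residueE m : Posz (residue m) = (m %% L)%Z.
Proof.
have m0 : 0 <= (m %% L)%Z by rewrite modz_ge0.
rewrite /residue inordK ?gez0_abs //.
by rewrite -ltz_nat gez0_abs // ltz_pmod.
Qed.

Lemma residue_inj m k : (m = k %[mod L])%Z -> residue m = residue k.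
Proof. by rewrite /residue => ->. Qed.

Lemma residue_ord l : residue l = l.
Proof. by apply: val_inj; apply: Posz_inj; rewrite [LHS]residueE modz_small //= ltz_nat. Qed.

Lemma residueD m k : residue (m + k) = residue m + residue k.
Proof.
apply: val_inj; apply: Posz_inj; rewrite Posz_ordD !residueE.
by rewrite modzDml modzDmr.
Qed.

Lemma residue0 : residue 0 = 0.
Proof. by rewrite -(residue_ord 0). Qed.

Lemma residueN m : residue (- m) = - residue m.
Proof.
by apply/eqP; rewrite -subr_eq0 opprK -residueD addNr residue0.
Qed.

Lemma perE x m : per x m = x (residue m) 0.
Proof.
rewrite /per; case: insubP => [i _ im|] /=.
  by congr (x _ _); rewrite /residue -im inord_val.
by rewrite -leqNgt -lez_nat gez0_abs ?modz_ge0 // leNgt ltz_pmod.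
Qed.

Lemma expi_chi l k :
  expi (- (2 * pi * l%:R * k%:~R / L%:R)) = (chi l (residue k) : C)^*.
Proof.
rewrite expiN; congr (_ ^*); rewrite /chi.
transitivity (unity_root R n (l%:Z * k)).
  by rewrite /unity_root intrM mulrA.
by apply: unity_root_mod; rewrite residueE modzMmr.
Qed.

(** For fixed [p], the sequence whose normalised Fourier transform in [l] is the ambiguity function
    at time shift [p]. *)
Definition lag x p l : C := x l 0 * (x (l - p) 0)^*.

Lemma gaborE phi x m k : gabor phi x m k = (Num.sqrt L%:R)^-1%:C *
  \sum_l x l 0 * (phi (l - residue m) 0)^* * (chi l (residue k))^*.
Proof.
congr (_ * _); apply: eq_bigr => l _.
by rewrite expi_chi perE residueD residueN residue_ord.
Qed.

Lemma ambiguityE x m k : ambiguity x m k =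
  (Num.sqrt L%:R)^-1%:C * \sum_l lag x (residue m) l * (chi l (residue k))^*.
Proof. exact: gaborE. Qed.

Lemma ambiguity_residue x m k :
  ambiguity x (residue m) (residue k) = ambiguity x m k.
Proof. by rewrite !ambiguityE !residue_ord. Qed.

Lemma sqr_inv_sqrtL : (Num.sqrt (L%:R : R))^-1 ^+ 2 = L%:R^-1.
Proof. by rewrite exprVn sqr_sqrtr ?ler0n. Qed.

Lemma dftE x p :
  dft x p 0 = (Num.sqrt L%:R)^-1%:C * \sum_l x l 0 * (chi l p)^*.
Proof.
rewrite mxE; congr (_ * _); apply: eq_bigr => l _.
by have := expi_chi l p; rewrite residue_ord => <-.
Qed.

Lemma mul_inv_sqrtL : (Num.sqrt (L%:R : R))^-1%:C * (Num.sqrt L%:R)^-1%:C = L%:R^-1.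
Proof.
by rewrite -rmorphM -expr2 sqr_inv_sqrtL fmorphV rmorph_nat.
Qed.

Lemma dft_inversion x l :
  x l 0 = (Num.sqrt L%:R)^-1%:C * \sum_k dft x k 0 * chi l k.
Proof.
under eq_bigr do rewrite dftE -mulrA.
rewrite -big_distrr /= mulrA mul_inv_sqrtL.
under eq_bigr => k _. 
  rewrite big_distrl /=; under eq_bigr => l' _.
    rewrite -mulrA [_^* * _]mulrC -chiNl -chiDl.
    over.
  over.
rewrite exchange_big /= (bigD1 l) //= [X in _ + X]big1 => [|l' l'l].
  under eq_bigr do rewrite subrr chi0l mulr1.
  by rewrite sumr_const card_ord addr0 -[x l 0 *+ _]mulr_natl mulKf ?pnatr_eq0.
rewrite -big_distrr /=; under eq_bigr do rewrite chiC.
by rewrite sum_chi subr_eq0 eq_sym (negbTE l'l) !mulr0.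
Qed.

Lemma bandlimited_dft B x (k : 'I_L) :
  bandlimited B x -> dft x k 0 != 0 ->
  exists2 b : nat, (b <= 2 * B)%N & k = residue (b%:Z - B%:Z).
Proof.
move=> /fintype.subsetP xB k0; have := xB k; rewrite !inE k0 => /(_ isT).
case/existsP=> b /eqP kb; exists b; first by rewrite -ltnS.
by rewrite -(residue_ord k); apply: residue_inj.
Qed.

(** Expanding both factors of [lag] by Fourier inversion, the sum over [l] leaves only pairs of
    frequencies [a], [b] with [a - b = k]. Two frequencies of the band differ by an element of {-2B,
    ..., 2B}. *)
Lemma ambiguity_bandlimited B x m k : bandlimited B x ->
  (forall j : nat, (j <= 4 * B)%N -> residue k <> residue (j%:Z - (2 * B)%:Z)) ->
  ambiguity x m k = 0.
Proof.
move=> xB kB; rewrite ambiguityE; apply/eqP; rewrite mulf_eq0; apply/orP; right.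
rewrite /lag; set p := residue m; apply/eqP.
under eq_bigr => l _.
  rewrite (dft_inversion x l) (dft_inversion x (l - p)) rmorphM rmorph_sum /=.
  rewrite mulrACA big_distrlr /= -[_ * _ * (chi l _)^*]mulrA big_distrl /=.
  under eq_bigr do rewrite big_distrl /=.
  over.
rewrite -big_distrr /= exchange_big /= big1 ?mulr0 // => a _.
rewrite exchange_big /= big1 // => b _.
have [a0|a0] := eqVneq (dft x a 0) 0.
  by apply: big1 => l _; rewrite a0 !mul0r.
have [b0|b0] := eqVneq (dft x b 0) 0.
  by apply: big1 => l _; rewrite b0 mul0r conjC0 mulr0 mul0r.
have [a' a'B aE] := bandlimited_dft xB a0.
have [b' b'B bE] := bandlimited_dft xB b0.
under eq_bigr => l _.
  rewrite rmorphM /= chiDl rmorphM /= -!chiNr.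
  rewrite (_ : _ * _ * chi l (- residue k) = dft x a 0 * (dft x b 0)^* * chi (- p) (- b) *
    chi l (a - b - residue k)); last by rewrite !chiDr; ring.
  over.
rewrite -big_distrr /= sum_chi subr_eq0.
case: eqVneq => [abk|]; last by rewrite !mulr0.
(* The difference [a' - b'] is written as [j - 2B] with [j = a' + 2B - b']; the natural subtraction
   does not truncate since [b' <= 2B]. *)
have abB : (a' + 2 * B - b' <= 4 * B)%N by lia.
case: (kB _ abB); rewrite -abk aE bE -residueN -residueD.
by congr residue; lia.
Qed.

(** Opening the squared modulus gives a double sum over [l], [l']; summing over the frequency [j]
    retains only [l' = l - p]. *)
Lemma sum_spectrogram phi x (m p : 'I_L) :
  \sum_(j < L) (normc (gabor phi x m j) ^+ 2)%:C * chi j p =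
  \sum_l lag x p l * (lag phi p (l - m))^*.
Proof.
under eq_bigr => j _.
  rewrite -mulc_conj gaborE !residue_ord rmorphM /= conj_real.
  rewrite mulrACA mul_inv_sqrtL rmorph_sum big_distrlr /= -mulrA big_distrl /=.
  under eq_bigr do rewrite big_distrl /=.
  over.
rewrite /= -big_distrr exchange_big big_distrr /=; apply: eq_bigr => l _.
under eq_bigr => j _.
  under eq_bigr => l' _.
    rewrite !rmorphM /= !conjCK -chiNl (chiC j p).
    rewrite (_ : _ * _ * chi p j = x l 0 * (phi (l - m) 0)^* * (x l' 0)^* *
      phi (l' - m) 0 * chi (- l + l' + p) j); last by rewrite !chiDl; ring.
    over.
  over.
rewrite exchange_big /= (bigD1 (l - p)) //= [X in _ + X]big1 => [|l' l'p].
  have -> : - l + (l - p) + p = 0 by rewrite addKr addNr.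
  under eq_bigr do rewrite chi0l mulr1.
  rewrite sumr_const card_ord addr0 -[X in _ * X = _]mulr_natl mulKf ?pnatr_eq0 //.
  by rewrite /lag rmorphM /= conjCK addrAC; ring.
rewrite -big_distrr /=; under eq_bigr do rewrite chiC.
rewrite sum_chi [- l + l']addrC addrAC -addrA -[p - l]opprB subr_eq0.
by rewrite (negbTE l'p) !mulr0.
Qed.

(** The previous identity is a correlation in [m], so a Fourier transform in [m] turns it into a
    product; the substitution of [l - m] for [m] separates the two sums. *)
Lemma sum_sum_spectrogram phi x (p k : 'I_L) :
  \sum_(m < L) (\sum_(j < L) (normc (gabor phi x m j) ^+ 2)%:C * chi j p) *
    (chi m k)^* = L%:R * (ambiguity x p k * (ambiguity phi p k)^*).
Proof.
under eq_bigr do rewrite sum_spectrogram big_distrl /=.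
rewrite exchange_big /= !ambiguityE !residue_ord rmorphM /= conj_real.
rewrite [X in _ * X]mulrACA mul_inv_sqrtL mulVKf ?pnatr_eq0 //.
rewrite rmorph_sum big_distrl /=; apply: eq_bigr => l _.
rewrite big_distrr /= (reindex_inj (subrI l)) /=; apply: eq_bigr => j _.
by rewrite subKr chiDl chiNl !rmorphM /= !conjCK; ring.
Qed.

Lemma frobenius_sqr (M : 'M[R]_L) :
  frobenius M ^+ 2 = \sum_i \sum_j `|M i j| ^+ 2.
Proof.
rewrite sqr_sqrtr //; apply: sumr_ge0 => i _; apply: sumr_ge0 => j _.
exact: sqr_ge0.
Qed.

(** Parseval is applied once in each variable. The two factors [L] this costs cancel against the
    square of the factor [L] in [sum_sum_spectrogram]. *)
Lemma frobenius_ambiguity phi x y :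
  frobenius (measurements phi x - measurements phi y) ^+ 2 =
  \sum_(p < L) \sum_(k < L) normc (ambiguity x p k - ambiguity y p k) ^+ 2 *
    normc (ambiguity phi p k) ^+ 2.
Proof.
set D := _ - _; rewrite frobenius_sqr.
have L0 : L%:R != 0 :> R by rewrite pnatr_eq0.
pose g (m p : 'I_L) : C := \sum_(j < L) (D m j)%:C * chi j p.
have gP (m : 'I_L) : \sum_p normc (g m p) ^+ 2 = L%:R * \sum_j `|D m j| ^+ 2.
  by rewrite parseval_conj; under eq_bigr do rewrite normc_real.
have gE (p k : 'I_L) : \sum_m g m p * (chi m k)^* =
    L%:R * ((ambiguity x p k - ambiguity y p k) * (ambiguity phi p k)^*).
  rewrite mulrBl mulrBr -!sum_sum_spectrogram -sumrB; apply: eq_bigr => m _.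
  rewrite -mulrBl -sumrB; congr (_ * _); apply: eq_bigr => j _.
  by rewrite !mxE rmorphB mulrBl.
apply: (mulfI L0); rewrite big_distrr /=.
under eq_bigr do rewrite -gP.
rewrite exchange_big /=; apply: (mulfI L0); rewrite !big_distrr /=.
apply: eq_bigr => p _; rewrite -parseval !big_distrr /=.
apply: eq_bigr => k _; rewrite gE [in LHS]ComplexField.Normc.normcM.
rewrite [in LHS]ComplexField.Normc.normcM normc_conj.
rewrite -[X in normc X](rmorph_nat (real_complex R)) normc_real ger0_norm //.
by ring.
Qed.

(** The normalisation by the inverse root of [L] makes the transform from [lag x p] to the ambiguity
    function unitary, hence no constant. *)
Lemma lag_ambiguity x y (p : 'I_L) :
  \sum_l normc (lag x p l - lag y p l) ^+ 2 =
  \sum_(k < L) normc (ambiguity x p k - ambiguity y p k) ^+ 2.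
Proof.
have L0 : L%:R != 0 :> R by rewrite pnatr_eq0.
apply: (mulfI L0); rewrite -parseval big_distrr /=; apply: eq_bigr => k _.
rewrite !ambiguityE !residue_ord -mulrBr -sumrB ComplexField.Normc.normcM exprMn normc_real.
rewrite ger0_norm ?invr_ge0 ?sqrtr_ge0 // sqr_inv_sqrtL mulVKf //.
by congr (normc _ ^+ 2); apply: eq_bigr => l _; rewrite mulrBl.
Qed.

(** Only the row [p = residue m] of [frobenius_ambiguity] is kept. Within the band of width 2B the
    weight [c |A[phi]|] is at least 1; elsewhere both ambiguity functions vanish. *)
Lemma lag_stability B phi x y m (c : R) :
    bandlimited B x -> bandlimited B y -> 0 < c ->
    (forall j : nat, (j <= 4 * B)%N ->
      1 / c <= normc (ambiguity phi m (j%:Z - (2 * B)%:Z))) ->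
  \sum_l normc (lag x (residue m) l - lag y (residue m) l) ^+ 2 <=
  (c * frobenius (measurements phi x - measurements phi y)) ^+ 2.
Proof.
move=> xB yB c0 phiB; rewrite lag_ambiguity exprMn frobenius_ambiguity.
rewrite [X in _ <= _ * X](bigD1 (residue m)) //= mulrDr.
apply: ler_wpDr.
  apply: mulr_ge0; first exact: sqr_ge0.
  by do 2![apply: sumr_ge0 => ? _]; rewrite mulr_ge0 ?sqr_ge0.
rewrite big_distrr /=; apply: ler_sum => k _.
have [/existsP[j /eqP kj]|] :=
    boolP [exists j : 'I_(4 * B).+1, k == residue (j%:Z - (2 * B)%:Z)].
  rewrite mulrCA ler_peMr ?sqr_ge0 // kj ambiguity_residue -exprMn.
  by rewrite exprn_ege1 // -ler_pdivrMl // mulrC phiB // -ltnS.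
rewrite negb_exists => /forallP kN.
have kB (j : nat) : (j <= 4 * B)%N ->
    residue k <> residue (j%:Z - (2 * B)%:Z).
  rewrite residue_ord -ltnS => jB kj.
  by have := kN (Ordinal jB); rewrite kj eqxx.
rewrite (ambiguity_bandlimited _ xB kB) (ambiguity_bandlimited _ yB kB) subrr ComplexField.Normc.normc0.
by rewrite expr0n /= mul0r mulr0.
Qed.

End GaborTransform.

(** * Cauchy-Schwarz and Minkowski inequalities for finite sums *)

Section CauchySchwarz.
Variables (R : rcfType) (I : Type).
Implicit Types (r : seq I) (P : pred I) (f g : I -> R).

(** The relation [c ^+ 2 <= a * b] between nonnegative [a], [b] and a real [c] is stable under
    addition: the cross terms satisfy [2 c c' <= a b' + a' b] by the arithmetic-geometric mean
    inequality. *)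
Lemma cauchy_schwarz r P f g :
  (\sum_(i <- r | P i) f i * g i) ^+ 2 <=
  (\sum_(i <- r | P i) f i ^+ 2) * \sum_(i <- r | P i) g i ^+ 2.
Proof.
pose K (a b c : R) := [/\ 0 <= a, 0 <= b & c ^+ 2 <= a * b].
suff [] : K (\sum_(i <- r | P i) f i ^+ 2) (\sum_(i <- r | P i) g i ^+ 2)
            (\sum_(i <- r | P i) f i * g i) by [].
apply: (big_ind3 K); first by split; rewrite ?expr0n ?mulr0.
  move=> a b c a' b' c' [a0 b0 ab] [a'0 b'0 ab']; split; rewrite ?addr_ge0 //.
  have u0 : 0 <= a * b' by rewrite mulr_ge0.
  have v0 : 0 <= a' * b by rewrite mulr_ge0.
  have uv : (c * c') ^+ 2 <= (a * b') * (a' * b).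
    rewrite exprMn [leRHS](_ : _ = a * b * (a' * b')); last by ring.
    by rewrite ler_pM ?sqr_ge0.
  suff : 2 * (c * c') <= a * b' + a' * b by lra.
  move: (a * b') (a' * b) (c * c') u0 v0 uv => u v w u0 v0 uv.
  rewrite leNgt; apply/negP => lt_uv.
  have : 0 < (2 * w - (u + v)) * (2 * w + (u + v)) by rewrite mulr_gt0; lra.
  by have := sqr_ge0 (u - v); lra.
by move=> i _; split; rewrite ?sqr_ge0 // exprMn.
Qed.

Lemma sum_sqr_le r P f :
  (\sum_(i <- r | P i) f i) ^+ 2 <=
  (\sum_(i <- r | P i) 1) * \sum_(i <- r | P i) f i ^+ 2.
Proof.
have := cauchy_schwarz r P (fun=> 1) f.
by under eq_bigr do rewrite mul1r; under [in leRHS]eq_bigr do rewrite expr1n.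
Qed.

Lemma minkowski2 r P f g :
  \sum_(i <- r | P i) (f i + g i) ^+ 2 <=
  (Num.sqrt (\sum_(i <- r | P i) f i ^+ 2) +
   Num.sqrt (\sum_(i <- r | P i) g i ^+ 2)) ^+ 2.
Proof.
have f0 : 0 <= \sum_(i <- r | P i) f i ^+ 2 by apply: sumr_ge0 => *; exact: sqr_ge0.
have g0 : 0 <= \sum_(i <- r | P i) g i ^+ 2 by apply: sumr_ge0 => *; exact: sqr_ge0.
rewrite sqrrD !sqr_sqrtr // -sqrtrM //.
under eq_bigr do rewrite sqrrD.
rewrite !big_split /= lerD2r lerD2l -mulr2n lerMn2r /=.
rewrite (le_trans (ler_norm _)) // -sqrtr_sqr; apply: ler_wsqrtr; exact: cauchy_schwarz.
Qed.

End CauchySchwarz.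

(** * Phases and relative phases of complex numbers *)

Section RelativePhase.
Variable R : rcfType.
Local Notation C := R[i].
Implicit Types (a b u v : C) (r s d : R).

(* With t = Re (u conj(v)), the bound < d <= r forces t >= 0; then
   |r u - s v|^2 >= r^2 (1 - t^2) >= r^2 (1 - t) = r^2 |u - v|^2 / 2. *)
Lemma phase_dist u v r s d :
    normc u = 1 -> normc v = 1 -> 0 < d <= r -> 0 <= s ->
    normc (r%:C * u - s%:C * v) < d ->
  d ^+ 2 * normc (u - v) ^+ 2 <= 2 * normc (r%:C * u - s%:C * v) ^+ 2.
Proof.
move=> u1 v1 /andP[d0 dr] s0 lt_d.
have : normc (r%:C * u - s%:C * v) ^+ 2 < d ^+ 2.
  by rewrite ltr_pXn2r // ?nnegrE ?normc_ge0 // ltW.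
have := normc_sqr u; have := normc_sqr v; rewrite u1 v1 expr1n !normc_sqr.
case: u v {u1 v1 lt_d} => [p q] [e f] /= ef1 pq1.
set t := p * e + q * f.
have -> : (r * p - 0 * q - (s * e - 0 * f)) ^+ 2 +
          (r * q + 0 * p - (s * f + 0 * e)) ^+ 2 =
          r ^+ 2 * (p ^+ 2 + q ^+ 2) + s ^+ 2 * (e ^+ 2 + f ^+ 2) - 2 * r * s * t.
  by rewrite /t; ring.
have -> : (p - e) ^+ 2 + (q - f) ^+ 2 =
          (p ^+ 2 + q ^+ 2) + (e ^+ 2 + f ^+ 2) - 2 * t by rewrite /t; ring.
have t1 : t <= 1.
  have : 0 <= (p - e) ^+ 2 + (q - f) ^+ 2 by rewrite addr_ge0 ?sqr_ge0.
  by rewrite /t; nra.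
rewrite -pq1 -ef1 !mulr1 => lt_d2.
have dr2 : d ^+ 2 <= r ^+ 2 by rewrite ler_sqr ?nnegrE // ltW // (lt_le_trans d0).
have r0 : 0 < r by exact: lt_le_trans dr.
have t0 : 0 <= t.
  rewrite leNgt; apply/negP => tN.
  have : 0 <= r * s * - t by rewrite !mulr_ge0 ?oppr_ge0 // ltW.
  by have := sqr_ge0 s; lra.
have h1 : 0 <= (s - r * t) ^+ 2 by exact: sqr_ge0.
have h2 : r ^+ 2 * (1 - t) <= r ^+ 2 * ((1 - t) * (1 + t)).
  by rewrite ler_wpM2l ?sqr_ge0 // ler_peMr ?subr_ge0 // lerDl.
have h3 : d ^+ 2 * (1 - t) <= r ^+ 2 * (1 - t) by rewrite ler_wpM2r ?subr_ge0.
by nra.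
Qed.

Definition phase a : C := a / (normc a)%:C.

(** No condition on [a] is required, since [phase 0] is 0. *)
Lemma phaseE a : a = (normc a)%:C * phase a.
Proof.
have [->|a0] := eqVneq a 0; first by rewrite /phase mul0r mulr0.
by rewrite /phase mulrC divfK // -(rmorph0 (real_complex R)) (inj_eq (@complexI _)) normc_eq0.
Qed.

Lemma normc_phase a : a != 0 -> normc (phase a) = 1.
Proof.
move=> a0; rewrite /phase ComplexField.Normc.normcM ComplexField.Normc.normcV.
by rewrite normc_real ger0_norm ?normc_ge0 // divff // normc_eq0.
Qed.

Definition relative_phase a b : C := phase a * (phase b)^*.

Lemma normc_relative_phase a b : a != 0 -> b != 0 -> normc (relative_phase a b) = 1.
Proof.
move=> a0 b0.
by rewrite ComplexField.Normc.normcM normc_conj !normc_phase ?mulr1.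
Qed.

(** Multiplying by the unit number [phase b * (phase a')^*] turns the difference of relative phases
    into [u - v], where [u] and [v] are the phases of the two products. Then [phase_dist] applies
    with [r = |a| |a'|] and threshold [d ^+ 2]. *)
Lemma relative_phase_dist a b a' b' d :
    0 < d -> d <= normc a -> d <= normc a' -> b != 0 -> b' != 0 ->
    normc (a * a'^* - b * b'^*) < d ^+ 2 ->
  d ^+ 2 * normc (relative_phase a b - relative_phase a' b') <=
  Num.sqrt 2 * normc (a * a'^* - b * b'^*).
Proof.
move=> d0 da da' b0 b'0.
have a0 : a != 0 by rewrite -normc_eq0 gt_eqF // (lt_le_trans d0).
have a'0 : a' != 0 by rewrite -normc_eq0 gt_eqF // (lt_le_trans d0).
pose u := phase a * (phase a')^*; pose v := phase b * (phase b')^*.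
have u1 : normc u = 1 by exact: normc_relative_phase.
have v1 : normc v = 1 by exact: normc_relative_phase.
have E c c' : c * c'^* = (normc c * normc c')%:C * (phase c * (phase c')^*).
  by rewrite {1}(phaseE c) {1}(phaseE c') !rmorphM /= conj_real; ring.
have -> : normc (relative_phase a b - relative_phase a' b') = normc (u - v).
  have w1 c : c != 0 -> phase c * (phase c)^* = 1.
    by move=> c0; rewrite mulc_conj normc_phase ?expr1n.
  rewrite -[LHS]mulr1 -{1}(normc_phase b0) -[LHS]mulr1.
  rewrite -{1}(normc_phase a'0) -(normc_conj (phase a')).
  rewrite -!ComplexField.Normc.normcM; congr normc.
  rewrite /relative_phase /u /v -[RHS](_ : u * (phase b * (phase b)^*) -
    v * (phase a' * (phase a')^*) = _); last by rewrite !w1 ?mulr1.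
  by rewrite /u /v; ring.
rewrite (E a a') (E b b') -/u -/v => lt_d.
rewrite -(ler_pXn2r (n := 2)) ?nnegrE ?mulr_ge0 ?(ltW d0) ?normc_ge0 ?sqrtr_ge0 //.
rewrite !exprMn sqr_sqrtr ?ler0n //; apply: phase_dist => //.
  by rewrite exprn_gt0 // expr2 ler_pM // ltW.
by rewrite mulr_ge0 ?normc_ge0.
Qed.

(** The intermediate point [|a| t phase(b)] separates modulus from phase. Its distance to [t b] is
    the difference of the moduli, that is, the difference of their squares divided by
    [|a| + |b| >= d]. *)
Lemma normc_sub_relative_phase a b t d :
    0 < d -> d <= normc a -> b != 0 -> normc t = 1 ->
  normc (a - t * b) <= `|normc a ^+ 2 - normc b ^+ 2| / d +
    normc a * normc (relative_phase a b - t).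
Proof.
move=> d0 da b0 t1.
have a0 : a != 0 by rewrite -normc_eq0 gt_eqF // (lt_le_trans d0).
apply: (le_trans (normc_distD ((normc a)%:C * (t * phase b)) _ _)).
rewrite addrC lerD //.
  rewrite (_ : _ - t * b = (normc a - normc b)%:C * (t * phase b)); last first.
    by rewrite {2}(phaseE b) rmorphB; ring.
  rewrite 2!ComplexField.Normc.normcM t1 normc_phase // !mulr1 normc_real.
  rewrite subr_sqr normrM ler_pdivlMr // ler_wpM2l // ger0_norm ?addr_ge0 ?normc_ge0 //.
  by rewrite (le_trans da) // lerDl normc_ge0.
rewrite {1}(phaseE a) -mulrBr ComplexField.Normc.normcM normc_real.
rewrite ger0_norm ?normc_ge0 // ler_wpM2l ?normc_ge0 //.
have -> : phase a - t * phase b = (relative_phase a b - t) * phase b.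
  rewrite mulrBl -mulrA [(phase b)^* * _]mulrC mulc_conj normc_phase //.
  by rewrite expr1n mulr1.
by rewrite ComplexField.Normc.normcM normc_phase // mulr1.
Qed.

End RelativePhase.

(** * Variation of a function along paths, and connected components *)

Section Components.
Variables (R : realType) (T : finZmodType) (o : T).
Implicit Types (e : rel T) (S : {set T}).

(* Since an edge {l, l - o} is named by l, the names along a simple path are
   pairwise distinct. *)
Lemma path_variation e (z : T -> R[i]) (F : T -> R) u p :
    (forall v w, e v w -> exists2 l,
      (v = l /\ w = l - o) \/ (v = l - o /\ w = l) & normc (z v - z w) <= F l) ->
    path e u p -> uniq (u :: p) ->
  exists s : seq T, [/\ uniq s, size s = size p,
    {in s, forall l, l \in u :: p /\ l - o \in u :: p} &
    normc (z u - z (last u p)) <= \sum_(l <- s) F l].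
Proof.
move=> eF; elim: p u => [|v p IHp] u /=.
  move=> _ _; exists [::]; split=> //.
  by rewrite subrr big_nil ComplexField.Normc.normc0.
case/andP=> /eF[l uvl zl] vp /andP[u_vp uniq_vp].
have [s [s1 s2 s3 s4]] := IHp _ vp uniq_vp.
(* Were [l] already used, both ends [l] and [l - o] would lie on the remaining path; but one of them
   is [u], which a simple path does not revisit. *)
have l_vp : l \notin s.
  apply: contra u_vp => /s3[lvp lovp].
  by case: uvl => [[-> _]|[-> _]].
exists (l :: s); split=> /=; first by rewrite l_vp.
- by rewrite s2.
- move=> k; rewrite inE => /predU1P[->|/s3[k1 k2]].
    by case: uvl => [[-> ->]|[-> ->]]; rewrite !inE !eqxx !orbT.
  by split; rewrite in_cons ?k1 ?k2 orbT.
rewrite big_cons; apply: le_trans (normc_distD (z v) _ _) _.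
exact: lerD.
Qed.

(** A walk is shortened to a simple path, whose edges have distinct names and number at most [#|S|].
    Cauchy-Schwarz then bounds the sum along it, and distinctness allows the squares to be summed
    over all [l]. *)
Lemma connect_variation e S (z : T -> R[i]) (F : T -> R) u v :
    (forall v w, induced e S v w -> exists2 l,
      (v = l /\ w = l - o) \/ (v = l - o /\ w = l) & normc (z v - z w) <= F l) ->
    (forall l, 0 <= F l) -> u \in S ->
    connect (induced e S) u v ->
  normc (z u - z v) <= Num.sqrt (#|S|%:R * \sum_l F l ^+ 2).
Proof.
move=> eF F0 uS /connectP[p0 p0P ->].
case: (shortenP p0P) => p pP up _.
have [s [s1 s2 _ s4]] := path_variation eF pP up.
apply: le_trans s4 _.
have sum0 : 0 <= \sum_(l <- s) F l by rewrite sumr_ge0.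
rewrite -(ger0_norm sum0) -sqrtr_sqr; apply: ler_wsqrtr.
apply: (le_trans (sum_sqr_le _ _ _)); apply: ler_pM.
- by rewrite sumr_ge0.
- by rewrite sumr_ge0 // => *; rewrite sqr_ge0.
- rewrite big_const_seq count_predT iter_addr_0 ler_nat s2.
  rewrite (@leq_trans #|u :: p|) //; first by rewrite (card_uniqP up) /=.
  (* A path of the induced graph that starts in [S] stays in [S]. *)
  apply: subset_leq_card; apply/fintype.subsetP => w; rewrite inE.
  case/predU1P=> [-> //|]; elim: p u {uS p0P s1 s2 up} pP => //= a p IHp u.
  case/andP=> /and3P[_ aS _] pP; rewrite inE => /predU1P[-> //|].
  exact: IHp pP.
rewrite [leLHS]big_uniq //= [leRHS](bigID (mem s)) /= lerDl.
by rewrite sumr_ge0 // => *; rewrite sqr_ge0.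
Qed.

End Components.

(** Symmetry makes connectedness an equivalence, so any vertex may serve as root. *)
Lemma in_component (T : finType) (e : rel T) (S A : {set T}) u :
    symmetric e -> A \in components e S -> u \in A ->
  A = [set v in S | connect (induced e S) u v].
Proof.
move=> e_sym /imsetP[w wS ->]; rewrite inE => /andP[uS wu].
have ind_sym : connect_sym (induced e S).
  by apply: sym_connect_sym => v v'; rewrite /induced e_sym andbCA.
by apply/setP=> v; rewrite !inE (same_connect ind_sym wu).
Qed.

(** Components sharing a vertex coincide, so by injectivity of [A] each vertex is counted at most
    once. *)
Lemma sum_components_le (R : realDomainType) (T : finType) (e : rel T)
    (S : {set T}) (K : nat) (A : 'I_K -> {set T}) (F : T -> R) :
    symmetric e -> injective A -> (forall k, A k \in components e S) ->
    (forall u, 0 <= F u) ->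
  \sum_k \sum_(u in A k) F u <= \sum_(u in S) F u.
Proof.
move=> e_sym A_inj A_comp F0.
have AS k u : u \in A k -> u \in S.
  by move=> uA; move: (uA); rewrite {1}(in_component e_sym (A_comp k) uA) inE => /andP[].
rewrite (exchange_big_dep (mem S)) /=; last by move=> k u _; exact: AS.
apply: ler_sum => u uS.
have [/existsP[k uk]|] := boolP [exists k, u \in A k].
  rewrite (big_pred1 k) // => k'; apply/idP/eqP => [uk'|-> //].
  apply: A_inj; rewrite (in_component e_sym (A_comp k) uk).
  exact: in_component e_sym (A_comp k') uk'.
by rewrite negb_exists => /forallP uN; rewrite big1 // => k; rewrite (negbTE (uN k)).
Qed.

(** * Phase stability on the essential support graph *)

Section Stability.
Variables (R : realType) (n : nat).
Local Notation L := n.+1.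
Local Notation C := R[i].
Implicit Types (x y phi : 'cV[C]_L) (delta : R).
Local Notation o := (residue n 1).

Lemma ess_edge_sym delta x : symmetric (ess_edge delta x).
Proof. by move=> l k; rewrite /ess_edge distnC andbCA. Qed.

Lemma ess_edge_adjacent delta x l k :
  ess_edge delta x l k -> l = k + o \/ k = l + o.
Proof.
case/and3P=> _ _; set d := absz _ => dP.
have ord_eq (i j : 'I_L) : (i%:Z = j%:Z + 1 %[mod L])%Z -> i = j + o.
  move=> ij; rewrite -{1}(residue_ord i) -{1}(residue_ord j) -residueD.
  exact: residue_inj.
have := ltn_ord l; have := ltn_ord k => kL lL.
have : [\/ l%:Z = k%:Z + 1, k%:Z = l%:Z + 1, l%:Z + L%:Z = k%:Z + 1
         | k%:Z + L%:Z = l%:Z + 1].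
  (* Here [n = L - 1]: the last two cases are the wrap-around edges, including for [L = 1] the loop
     at the only vertex. *)
  have : [\/ (l = k.+1 :> nat), (k = l.+1 :> nat), (l + n = k)%N | (k + n = l)%N].
    have [lk|kl] := leqP l k.
      have dE : d = (k - l)%N by rewrite /d distnC distnEl.
      have [|dn] := eqVneq (k - l)%N 1%N; first by constructor 2; lia.
      by constructor 3; lia.
    have dE : d = (l - k)%N by rewrite /d distnEl // ltnW.
    have [|dn] := eqVneq (l - k)%N 1%N; first by constructor 1; lia.
    by constructor 4; lia.
  by case=> ?; [constructor 1|constructor 2|constructor 3|constructor 4]; lia.
case=> lk; [left|right|left|right]; apply: ord_eq; rewrite -?lk ?modzDr //.
Qed.

Lemma lag0 x l : lag x 0 l = (normc (x l 0) ^+ 2)%:C.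
Proof. by rewrite /lag subr0 mulc_conj. Qed.

Lemma relative_phase_connect delta x y (S : {set 'I_L}) (A : R) u v :
    0 < delta -> 0 <= A -> S = ess_vertices delta x :&: supp y ->
    \sum_l normc (lag x o l - lag y o l) ^+ 2 <= A ^+ 2 ->
    u \in S -> v \in S -> connect (induced (ess_edge delta x) S) u v ->
  normc (relative_phase (x u 0) (y u 0) - relative_phase (x v 0) (y v 0)) <=
  Num.sqrt (2 * #|S|%:R) * A / delta ^+ 2.
Proof.
move=> d0 A0 SE lagA uS vS uv.
have d2 : 0 < delta ^+ 2 by rewrite exprn_gt0.
have S_x w : w \in S -> delta <= normc (x w 0).
  by rewrite SE !inE => /andP[].
have S_y w : w \in S -> y w 0 != 0 by rewrite SE !inE => /andP[].
have x_neq0 w : w \in S -> x w 0 != 0.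
  by move=> wS; rewrite -normc_eq0 gt_eqF // (lt_le_trans d0) // S_x.
pose E l := normc (lag x o l - lag y o l).
have E0 l : 0 <= E l by exact: normc_ge0.
(* A single term is bounded by the whole sum; this supplies the smallness condition of
   [relative_phase_dist] on every edge at once. *)
have EA l : E l <= A.
  rewrite -(ler_pXn2r (n := 2)) ?nnegrE // (le_trans _ lagA) //.
  by rewrite (bigD1 l) //= lerDl sumr_ge0 // => *; exact: sqr_ge0.
(* For large [A] the trivial bound 2 on the distance of unit numbers suffices: it equals the root of
   [2 * 2], and [u != v] gives [#|S| >= 2]. *)
have [d2A|Ad2] := leP (delta ^+ 2) A.
  have [->|uv_neq] := eqVneq u v.
    by rewrite subrr ComplexField.Normc.normc0 divr_ge0 ?mulr_ge0 ?sqrtr_ge0 // ltW.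
  have S2 : (2 <= #|S|)%N by apply/card_gt1P; exists u, v.
  apply: (@le_trans _ _ 2).
    apply: le_trans (le_normcD _ _) _.
    by rewrite normcN !normc_relative_phase ?S_y ?x_neq0.
  rewrite [leLHS](_ : _ = Num.sqrt (2 * 2)); last first.
    by rewrite -expr2 sqrtr_sqr ger0_norm.
  rewrite -mulrA -[leLHS]mulr1 ler_pM ?sqrtr_ge0 //.
    by apply: ler_wsqrtr; rewrite ler_wpM2l // ler_nat.
  by rewrite ler_pdivlMr // mul1r.
pose F l := Num.sqrt 2 / delta ^+ 2 * E l.
have c0 : 0 <= Num.sqrt 2 / delta ^+ 2 :> R by rewrite divr_ge0 ?sqrtr_ge0 // ltW.
have step l w : w = l - o -> l \in S -> w \in S ->
  normc (relative_phase (x l 0) (y l 0) - relative_phase (x w 0) (y w 0)) <= F l.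
  move=> -> lS wS; rewrite /F mulrAC ler_pdivlMr // mulrC.
  apply: relative_phase_dist; rewrite ?S_x ?S_y //.
  exact: le_lt_trans (EA l) Ad2.
apply: le_trans (connect_variation (o := o) (F := F)
  (z := fun l => relative_phase (x l 0) (y l 0)) _ _ uS uv) _.
- move=> a b /and3P[aS bS /ess_edge_adjacent[] ab].
    by exists a; [left; rewrite ab addrK|apply: step => //; rewrite ab addrK].
  exists b; first by right; rewrite ab addrK.
  by rewrite normc_subC; apply: step => //; rewrite ab addrK.
- by move=> l; rewrite mulr_ge0.
have -> : Num.sqrt (2 * #|S|%:R) * A / delta ^+ 2 =
    `|Num.sqrt (2 * #|S|%:R) * A / delta ^+ 2| :> R.
  by rewrite ger0_norm // divr_ge0 ?mulr_ge0 ?sqrtr_ge0 // ltW.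
rewrite -sqrtr_sqr; apply: ler_wsqrtr.
under eq_bigr do rewrite exprMn.
rewrite -big_distrr /= !exprMn !exprVn !sqr_sqrtr ?mulr_ge0 //.
rewrite [leRHS](_ : _ = #|S|%:R * (2 / delta ^+ 2 ^+ 2 * A ^+ 2)); last by ring.
by rewrite !ler_wpM2l // divr_ge0 // ltW // exprn_gt0.
Qed.

(** One angle [t], the argument of the relative phase at a root of the component, serves all its
    vertices. *)
Lemma component_phase delta x y (S A : {set 'I_L}) (D : R) :
    0 < delta -> 0 <= D -> S = ess_vertices delta x :&: supp y ->
    \sum_l normc (lag x o l - lag y o l) ^+ 2 <= D ^+ 2 ->
    A \in components (ess_edge delta x) S ->
  exists t : R, forall l, l \in A ->
    normc (x l 0 - expi t * y l 0) <=
    `|normc (x l 0) ^+ 2 - normc (y l 0) ^+ 2| / delta +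
    Num.sqrt (2 * #|S|%:R) * D / delta ^+ 2 * normc (x l 0).
Proof.
move=> d0 D0 SE lagD /imsetP[u uS ->].
have SP w : w \in S -> delta <= normc (x w 0) /\ y w 0 != 0.
  by rewrite SE !inE => /andP[].
have [xu yu] := SP u uS.
have xu0 : x u 0 != 0 by rewrite -normc_eq0 gt_eqF // (lt_le_trans d0).
have [t tE] := expi_surj (normc_relative_phase xu0 yu).
exists t => l; rewrite inE => /andP[lS ul]; have [xl yl] := SP l lS.
apply: le_trans (normc_sub_relative_phase d0 xl yl (normc_expi t)) _.
rewrite lerD2l mulrC ler_wpM2r ?normc_ge0 // -tE normc_subC.
exact: relative_phase_connect lagD uS lS ul.
Qed.

End Stability.

Theorem theorem3p10 (R : realType) (L : nat) (hL : (0 < L)%N)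
    (delta : R) (hdelta : 0 < delta)
    (B : nat) (x y : 'cV[R[i]]_L)
    (hx : bandlimited B x) (hy : bandlimited B y)
    (Sd : {set 'I_L}) (hSd : Sd = ess_vertices delta x :&: supp y)
    (K : nat) (S : 'I_K -> {set 'I_L})
    (hSinj : injective S)
    (hS : [set S k | k : 'I_K] = components (ess_edge delta x) Sd)
    (phi : 'cV[R[i]]_L) (c : R) (hc : 0 < c)
    (hphi : 1 / c <= min_ambiguity B phi) :
  inf (range (fun alpha : 'I_K -> R =>
         \sum_(k < K) l2norm (S k) (x - expi (alpha k) *: y)))
  <= c * Num.sqrt K%:R / delta *
     (1 + Num.sqrt (2 * #|Sd|%:R) * l2norm Sd x / delta) *
     frobenius (measurements phi x - measurements phi y).
Proof.
(* Writing [L] as [n.+1] gives ['I_L] its group structure. *)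
case: L => [//|n] in hL x y hx hy Sd hSd S hSinj hS phi hphi *.
set D := c * frobenius (measurements phi x - measurements phi y).
have D0 : 0 <= D by rewrite mulr_ge0 ?sqrtr_ge0 // ltW.
have phiB (m : 'I_2) (j : nat) : (j <= 4 * B)%N ->
    1 / c <= normc (ambiguity phi m%:Z (j%:Z - (2 * B)%:Z)).
  move=> jB; apply: le_trans hphi _.
  apply: le_trans (bigmin_le _ m _) _.
  exact: (bigmin_le _ (Ordinal (jB : (j < (4 * B).+1)%N))
    (fun j : 'I__ => normc (ambiguity phi m%:Z (j%:Z - (2 * B)%:Z)))).
have lag_1 := lag_stability hx hy hc (phiB 1).
have := lag_stability hx hy hc (phiB 0).
rewrite residue0 -/D in lag_1 * => lag_0.
have S_comp k : S k \in components (ess_edge delta x) Sd by rewrite -hS imset_f.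
have [alpha alphaP] := fin_all_exists (fun k =>
  component_phase hdelta D0 hSd lag_1 (S_comp k)).
set T := _ * D / delta ^+ 2 in alphaP.
have T0 : 0 <= T by rewrite divr_ge0 ?mulr_ge0 ?sqrtr_ge0 // ltW // exprn_gt0.
pose f l : R := `|normc (x l 0) ^+ 2 - normc (y l 0) ^+ 2| / delta.
pose g l : R := T * normc (x l 0).
have f0 l : 0 <= f l by rewrite divr_ge0 // ltW.
have g0 l : 0 <= g l by rewrite mulr_ge0 ?normc_ge0.
(* The differences of squared moduli are the lag-zero products, so their sum over [Sd] is part of
   the sum bounded in [lag_0]. *)
have normf : Num.sqrt (\sum_(l in Sd) f l ^+ 2) <= D / delta.
  rewrite -[leRHS]ger0_norm ?divr_ge0 ?(ltW hdelta) // -sqrtr_sqr.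
  apply: ler_wsqrtr.
  under eq_bigr do rewrite exprMn.
  rewrite exprMn -big_distrl /= ler_wpM2r ?sqr_ge0 //.
  apply: le_trans lag_0; under [leRHS]eq_bigr do rewrite !lag0 -rmorphB normc_real.
  rewrite [leRHS](bigID (mem Sd)) /= lerDl.
  by rewrite sumr_ge0 // => *; exact: sqr_ge0.
have normg : Num.sqrt (\sum_(l in Sd) g l ^+ 2) = T * l2norm Sd x.
  under eq_bigr do rewrite exprMn.
  by rewrite -big_distrr /= sqrtrM ?sqr_ge0 // sqrtr_sqr ger0_norm.
apply: (@le_trans _ _ (Num.sqrt K%:R * (D / delta + T * l2norm Sd x))); last first.
  rewrite le_eqVlt; apply/orP; left; apply/eqP; rewrite /T /D.
  by field; exact: lt0r_neq0.
(* The sums of norms are bounded below by 0, so the infimum is at most the value at the chosen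
   [alpha]. *)
apply: (@le_trans _ _ (\sum_k l2norm (S k) (x - expi (alpha k) *: y))).
  apply: ge_inf; last by exists alpha.
  by exists 0 => _ [a _ <-]; rewrite sumr_ge0 // => k _; exact: sqrtr_ge0.
have N0 : 0 <= D / delta + T * l2norm Sd x.
  exact: addr_ge0 (divr_ge0 D0 (ltW hdelta)) (mulr_ge0 T0 (sqrtr_ge0 _)).
have s0 : 0 <= \sum_k l2norm (S k) (x - expi (alpha k) *: y).
  by rewrite sumr_ge0 // => k _; exact: sqrtr_ge0.
rewrite -(ler_pXn2r (n := 2)) ?nnegrE ?mulr_ge0 ?sqrtr_ge0 //.
(* Cauchy-Schwarz over the [K] components produces the factor root of [K]; the squared norms then
   merge into one sum over [Sd]. *)
apply: le_trans (sum_sqr_le _ _ _) _.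
rewrite exprMn sqr_sqrtr // sumr_const card_ord ler_wpM2l //.
apply: (@le_trans _ _ (\sum_(l in Sd) (f l + g l) ^+ 2)).
  apply: le_trans (sum_components_le (ess_edge_sym delta x) hSinj S_comp _); last first.
    by move=> l; exact: sqr_ge0.
  apply: ler_sum => k _; rewrite sqr_sqrtr; last first.
    by rewrite sumr_ge0 // => *; exact: sqr_ge0.
  apply: ler_sum => l lS; rewrite !mxE ler_pXn2r ?nnegrE ?normc_ge0 ?addr_ge0 //.
  exact: alphaP.
(* Minkowski separates the modulus error [f] from the phase error [g]. *)
apply: le_trans (minkowski2 _ _ _ _) _.
rewrite normg ler_pXn2r ?nnegrE ?lerD2r //.
exact: addr_ge0 (sqrtr_ge0 _) (mulr_ge0 T0 (sqrtr_ge0 _)).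
Qed.
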